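(* Let $m$ be an odd positive integer and $r$ an even positive integer, and let $n$ be a positive integer. Then there exists a shiftable $SMR(m,n;r,2)$ if and only if $m\geq 3$, $r\geq 4$ and $mr=2n$.
   Context: A signed magic rectangle $SMR(m,n;r,s)$ is an $m\times n$ array, some of whose cells are filled with integers and the others empty, such that exactly $r$ cells in every row and exactly $s$ cells in every column are filled (so $mr=ns$), every element of $X$ appears exactly once in the array, and the sum of the entries of each row and of each column is zero, where (for $mr$ even) $X=\{\pm1,\pm2,\ldots,\pm mr/2\}$. An array is shiftable if every row and every column contains the same number of positive entries as negative entries. *)

(* Defs.v *)
From mathcomp Require Import all_boot all_order all_algebra.

Set Implicit Arguments.
Unset Strict Implicit.
Unset Printing Implicit Defensive.

Import Order.TTheory GRing.Theory Num.Theory.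
Local Open Scope ring_scope.

(* A partially filled array is a matrix over [option int]; an empty cell is
   [None].  In sums, and in counts of positive or negative entries, an empty
   cell is read as 0 and hence contributes nothing. *)
Definition entry (m n : nat) (A : 'M[option int]_(m, n)) (i : 'I_m) (j : 'I_n)
  : int := odflt 0 (A i j).

(* For N even this is {+-1, ..., +-N/2}; for N odd it is
   {0, +-1, ..., +-(N-1)/2}, the usual convention. *)
Definition smr_symbol (N : nat) (x : int) : bool :=
  (`|x| <= (N./2)%:Z) && ((x != 0) || odd N).

(* That every entry lies in X needs no separate clause: there are m * r filled
   cells, and X has m * r elements, each occurring. *)
Record is_SMR (m n r s : nat) (A : 'M[option int]_(m, n)) : Prop := IsSMR {
  smr_row_filled : forall i : 'I_m, #|[set j | A i j != None]| = r;
  smr_col_filled : forall j : 'I_n, #|[set i | A i j != None]| = s;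
  smr_once : forall x : int, smr_symbol (m * r) x ->
    exists! p : 'I_m * 'I_n, A p.1 p.2 = Some x;
  smr_row_sum : forall i : 'I_m, \sum_(j < n) entry A i j = 0;
  smr_col_sum : forall j : 'I_n, \sum_(i < m) entry A i j = 0
}.

Definition shiftable (m n : nat) (A : 'M[option int]_(m, n)) : Prop :=
  (forall i : 'I_m,
     #|[set j | 0 < entry A i j]| = #|[set j | entry A i j < 0]|) /\
  (forall j : 'I_n,
     #|[set i | 0 < entry A i j]| = #|[set i | entry A i j < 0]|).

(* Main.v *)
(** In a column with two filled cells the entries are x and -x, so an
    SMR(m,n;r,2) is a digraph on the rows whose arc k goes from the row holding
    -k to the row holding k.  If [1..n] is split into m parts of size r/2 with
    a common sum, one part for each row, then placing each part with plus signs in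
    its own row and with minus signs in the cyclically preceding row gives a
    shiftable array.  Such a splitting comes from a Kotzig array: r/2
    permutations of [0..m-1] with a constant pointwise sum.  One such pair is
    the identity and the reversal; for odd m there are also three such
    permutations, and pairs can be added to either.  Conversely, for r = 2 the
    entry 1 would share both its row and its column with -1. *)
Require Import Defs.
From mathcomp Require Import all_boot all_order all_algebra.
From mathcomp Require Import zify.

Import GRing.Theory Num.Theory.

(** * Kotzig arrays *)

(** Permutations are indexed by all of [nat], so that appending some needs no casts; only the first
    [h] enter the sum. *)
Definition kotzig (m h : nat) (p : nat -> 'I_m -> 'I_m) : Prop :=
  (forall t, injective (p t)) /\
  exists S, forall i, \sum_(t < h) p t i = S.

Lemma kotzig2 (m : nat) : exists p, kotzig m 2 p.
Proof.
exists (fun t => if t is 0 then id else @rev_ord m); split.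
  by case=> [|t]; [exact: inj_id | exact: rev_ord_inj].
by exists m.-1 => i; rewrite !big_ord_recr big_ord0 /=; have := ltn_ord i; lia.
Qed.

Lemma kotzig3 (k : nat) : exists p, kotzig k.*2.+1 3 p.
Proof.
(* Row 1 is the shift by k modulo 2k+1. Row 2 is 3k minus the other two: it takes the even values
   for i <= k and the odd values for i > k. *)
pose f (t i : nat) := match t with
  | 0 => i
  | 1 => if i <= k then i + k else i - k.+1
  | _ => if i <= k then k.*2 - i.*2 else (k.*2).*2.+1 - i.*2 end.
have f_lt t (i : 'I_k.*2.+1) : f t i < k.*2.+1.
  by case: t => [|[|t]] /=; have := ltn_ord i; try case: ifP; lia.
exists (fun t i => Ordinal (f_lt t i)); split.
  move=> t i j /(congr1 val) /= fij; apply/val_inj => /=.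
  have := ltn_ord i; have := ltn_ord j; move: fij.
  by case: t => [|[|t]] /=; try (case: ifP; case: ifP); lia.
exists (3 * k) => i; rewrite !big_ord_recr big_ord0 /=.
by have := ltn_ord i; case: ifP; lia.
Qed.

Lemma kotzigD2 (m h : nat) p : kotzig m h p -> exists q, kotzig m h.+2 q.
Proof.
move=> [p_inj [S pS]].
exists (fun t => if t < h then p t else if t == h then id else @rev_ord m).
split=> [t|].
  by case: ifP => _; [|case: ifP => _; [exact: inj_id | exact: rev_ord_inj]].
exists (S + m.-1) => i; rewrite !big_ord_recr /= ltnn eqxx.
rewrite [h.+1 < h]ltnNge leqnSn /= [h.+1 == h]gtn_eqF //= -(pS i).
under eq_bigr do rewrite ltn_ord.
by rewrite -addnA; congr (_ + _); have := ltn_ord i; lia.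
Qed.

Lemma kotzig_exists (m h : nat) : odd m -> 1 < h -> exists p, kotzig m h p.
Proof.
move=> m_odd.
have -> : m = (m./2).*2.+1 by rewrite -[LHS]odd_double_half m_odd.
have [N] := ubnP h; elim: N h => // N IH [|[|[|[|h]]]] // hN _.
- exact: kotzig2.
- exact: kotzig3.
- by have [|//|p /kotzigD2] := IH h.+2; first lia.
Qed.

(** Cut [0..hm-1] into h blocks of length m. Part i takes from block t the element at position
    [p t i]: each [p t] is a permutation, so these are disjoint transversals, and the Kotzig
    property makes their sums equal. *)
Lemma equal_sum_parts (m h : nat) : odd m -> 1 < h ->
  exists (c : 'I_(h * m) -> 'I_m) (S : nat), forall i,
    #|[set j | c j == i]| = h /\ \sum_(j | c j == i) j.+1 = S.
Proof.
move=> m_odd /(kotzig_exists m h m_odd)[p [p_inj [S pS]]].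
have G_lt (u : 'I_h * 'I_m) : u.1 * m + p u.1 u.2 < h * m.
  case: u => t i /=; have := ltn_ord (p t i); have := ltn_ord t; nia.
pose G u := Ordinal (G_lt u).
have G_inj : injective G.
  move=> [t i] [t' i'] /(congr1 val) /= e.
  have m0 : 0 < m by case: (m) m_odd.
  have et : t = t'.
    apply/val_inj => /=; move/(congr1 (divn^~ m)): e.
    by rewrite !divnMDl // !divn_small // !addn0.
  rewrite -et in e *; congr (_, _); apply: (p_inj t); apply/val_inj.
  exact: (addnI e).
have [G' GK G'K] : bijective G.
  by apply: inj_card_bij G_inj _; rewrite card_prod !card_ord.
(* Taking F = 1 gives the size of a part, and F j = j+1 its sum. *)
have sumG (F : 'I_(h * m) -> nat) i :
    \sum_(j | (G' j).2 == i) F j = \sum_t F (G (t, i)).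
  rewrite (reindex G) /=; last by exists G' => u _; [apply: GK | apply: G'K].
  under eq_bigl do rewrite GK.
  transitivity (\sum_t \sum_(k | k == i) F (G (t, k))).
    by rewrite pair_big_dep; apply: eq_big => -[].
  by apply: eq_bigr => t _; rewrite big_pred1_eq.
exists (fun j => (G' j).2), (\sum_(t < h) (t * m).+1 + S) => i; split.
  by rewrite -sum1dep_card sumG sum1_card card_ord.
by rewrite sumG -(pS i) -big_split.
Qed.

(** * The array built from an equal-sum splitting *)

Section CyclicArray.
Variables (m n h S : nat) (c : 'I_n -> 'I_m).
Hypotheses (m_gt1 : 1 < m) (n_def : m * h = n).
Hypothesis c_card : forall i, #|[set j | c j == i]| = h.
Hypothesis c_sum : forall i, \sum_(j | c j == i) j.+1 = S.

(** Columns are numbered from 0, so column j holds j+1 and its negative. The test [c j == ordS i]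
    says that row i cyclically precedes row [c j]. *)
Definition cyclic_array : 'M[option int]_(m, n) :=
  \matrix_(i, j) if c j == i then Some (Posz j.+1)
                 else if c j == ordS i then Some (- Posz j.+1)%R else None.

Local Notation A := cyclic_array.

Lemma ordS_neq (i : 'I_m) : (ordS i == i) = false.
Proof.
apply/negP => /eqP/(congr1 val) /=.
have := ltn_ord i; rewrite leq_eqVlt => /predU1P[e|lt]; last first.
  by rewrite modn_small //; lia.
by rewrite [X in X %% _]e modnn; lia.
Qed.

Lemma eq_ordS (i k : 'I_m) : (k == ordS i) = (i == ord_pred k).
Proof. by rewrite -(inj_eq (@ord_pred_inj m)) ordSK eq_sym. Qed.

Lemma cyclic_array_filled i j :
  (A i j != None) = (c j == i) || (c j == ordS i).
Proof. by rewrite mxE; case: (c j == i); case: (c j == ordS i). Qed.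

Lemma cyclic_array_pos i j : (0 < entry A i j)%R = (c j == i).
Proof. by rewrite /entry mxE; case: (c j == i); case: (c j == ordS i). Qed.

Lemma cyclic_array_neg i j : (entry A i j < 0)%R = (c j == ordS i).
Proof.
rewrite /entry mxE; case: eqP => [->|] /=; first by rewrite eq_sym ordS_neq.
by case: eqP.
Qed.

Lemma entry_cyclic_array i j : entry A i j =
  ((if c j == i then Posz j.+1 else 0)
   - (if c j == ordS i then Posz j.+1 else 0))%R.
Proof.
rewrite /entry mxE; case: eqP => [->|_] /=.
  by rewrite eq_sym ordS_neq subr0.
by case: eqP => _ /=; rewrite sub0r ?oppr0.
Qed.

Lemma cyclic_array_once x : smr_symbol (m * h.*2) x ->
  exists! u : 'I_m * 'I_n, A u.1 u.2 = Some x.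
Proof.
have -> : m * h.*2 = n.*2 by rewrite -n_def; lia.
rewrite /smr_symbol odd_double orbF doubleK => /andP[x_le x_neq0].
(* The absolute value of x determines its column, and the sign then determines its row. *)
have k_lt : `|x|.-1 < n by lia.
pose k := Ordinal k_lt.
have [x_gt0|x_le0] := ltrP 0 x.
- exists (c k, k); split=> [|[i j]] /=.
    by rewrite mxE eqxx /=; congr Some; lia.
  rewrite mxE; case: eqP => [<-|_].
    by case=> e; have -> : k = j by apply/val_inj => /=; lia.
  by case: eqP => // _ [e]; exfalso; lia.
- exists (ord_pred (c k), k); split=> [|[i j]] /=.
    rewrite mxE ord_predK eqxx; case: eqP => [e|_]; last by congr Some => /=; lia.
    by have := ordS_neq (ord_pred (c k)); rewrite ord_predK {1}e eqxx.
  rewrite mxE; case: eqP => [_ [e]|_]; first by exfalso; lia.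
  rewrite eq_ordS; case: eqP => // -> [e].
  by have -> : k = j by apply/val_inj => /=; lia.
Qed.

(** Row i holds part i with plus signs and part [ordS i] with minus signs. The parts are disjoint as
    m > 1, so the row has 2h filled cells and sum S - S = 0. *)
Lemma cyclic_array_SMR : is_SMR h.*2 2 A.
Proof.
split.
- move=> i.
  have -> : [set j | A i j != None]
          = [set j | c j == i] :|: [set j | c j == ordS i].
    by apply/setP => j; rewrite !inE cyclic_array_filled.
  rewrite cardsU !c_card addnn; apply/eqP.
  rewrite (_ : _ :&: _ = set0) ?cards0 ?subn0 //.
  apply/setP => j; rewrite !inE; apply/negP => /andP[/eqP-> ].
  by rewrite eq_sym ordS_neq.
- move=> j.
  have -> : [set i | A i j != None] = [set c j; ord_pred (c j)].
    by apply/setP => i; rewrite !inE cyclic_array_filled eq_ordS eq_sym.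
  by rewrite cards2 -eq_ordS eq_sym ordS_neq.
- exact: cyclic_array_once.
- move=> i; under eq_bigr do rewrite entry_cyclic_array.
  rewrite sumrB -!big_mkcond /=.
  by rewrite -!(big_morph Posz PoszD (erefl _)) !c_sum subrr.
- move=> j; under eq_bigr do rewrite entry_cyclic_array.
  rewrite sumrB -!big_mkcond /=.
  under eq_bigl do rewrite eq_sym.
  under [X in (_ - X)%R]eq_bigl do rewrite eq_ordS.
  by rewrite !big_pred1_eq subrr.
Qed.

Lemma cyclic_array_shiftable : shiftable A.
Proof.
split=> [i|j].
  rewrite -!sum1dep_card (eq_bigl _ _ (cyclic_array_pos i)).
  by rewrite (eq_bigl _ _ (cyclic_array_neg i)) !sum1dep_card !c_card.
transitivity #|[set c j]|.
  by apply: eq_card => i; rewrite !inE cyclic_array_pos eq_sym.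
rewrite cards1 -(cards1 (ord_pred (c j))).
by apply: eq_card => i; rewrite !inE cyclic_array_neg eq_ordS.
Qed.

End CyclicArray.

(** * Necessary conditions *)

Lemma SMR_size (m n r s : nat) (A : 'M[option int]_(m, n)) :
  is_SMR r s A -> m * r = s * n.
Proof.
case=> row_filled col_filled _ _ _.
have -> : m * r = \sum_i #|[set j | A i j != None]|.
  by under eq_bigr do rewrite row_filled; rewrite sum_nat_const card_ord.
have -> : s * n = \sum_j #|[set i | A i j != None]|.
  by under eq_bigr do rewrite col_filled; rewrite sum_nat_const card_ord mulnC.
under eq_bigr do rewrite -sum1dep_card big_mkcond.
by rewrite exchange_big; apply: eq_bigr => j _; rewrite -big_mkcond sum1dep_card.
Qed.

Lemma two_cells_opp (T : finType) (F : T -> option int) (a : T) (x : int) :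
  #|[set t | F t != None]| = 2 -> (\sum_t odflt 0 (F t) = 0)%R ->
  F a = Some x -> exists2 b, b != a & F b = Some (- x)%R.
Proof.
move=> /eqP/cards2P[u [v [uv F_supp]]] + Fa.
have [b [ba F_out]] : exists b, b != a /\
    forall t, t != a -> t != b -> F t = None.
  have out t : t != u -> t != v -> F t = None.
    move=> tu tv; apply/eqP/negPn.
    by have := in_set2 t u v; rewrite -F_supp inE (negPf tu) (negPf tv) => ->.
  have := in_set2 a u v; rewrite -F_supp inE Fa /= => /esym/orP[]/eqP->.
    by exists v; split; [rewrite eq_sym | exact: out].
  by exists u; split=> // t tv tu; exact: out.
(* The zero sum alone does not give this: for x = 0, an empty cell would also read as 0. The count
   of two filled cells does. *)
have Fb_filled : F b != None.
  apply/eqP => Fb; have := cards2 u v; rewrite uv -F_supp.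
  rewrite (_ : [set t | F t != None] = [set a]) ?cards1 //.
  apply/setP => t; rewrite !inE; have [->|ta] := eqVneq t a; first by rewrite Fa.
  by have [->|tb] := eqVneq t b; [rewrite Fb | rewrite F_out].
rewrite (bigD1 a) //= (bigD1 b) //= big1 ?addr0 => [|t /andP[ta tb]]; last first.
  by rewrite F_out.
rewrite Fa; case Fb: (F b) Fb_filled => [y|] //= _ xy.
by exists b => //; rewrite Fb; congr Some; lia.
Qed.

Lemma SMR_row_size_neq2 (m n r : nat) (A : 'M[option int]_(m, n)) :
  1 < m * r -> is_SMR r 2 A -> r != 2.
Proof.
move=> mr_gt1 [row_filled col_filled once row_sum col_sum].
apply/eqP => r2.
have [|[i j] /= [Aij _]] := once 1%R; first by rewrite /smr_symbol /=; lia.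
have [i' i'i Ai'j] := two_cells_opp _ (A^~ j) i _ (col_filled j) (col_sum j) Aij.
rewrite r2 in row_filled.
have [j' j'j Aij'] := two_cells_opp _ (A i) j _ (row_filled i) (row_sum i) Aij.
(* Both (i', j) and (i, j') hold -1, so uniqueness forces i' = i. *)
have [|u [_ uniq]] := once (- 1)%R; first by rewrite /smr_symbol /=; lia.
have := etrans (esym (uniq (i', j) Ai'j)) (uniq (i, j') Aij').
by case=> e _; rewrite e eqxx in i'i.
Qed.

Theorem theorem28 (m n r : nat) (m_odd : odd m) (r_even : ~~ odd r)
    (r_pos : 0 < r) (n_pos : 0 < n) :
  (exists A : 'M[option int]_(m, n), is_SMR r 2 A /\ shiftable A) <->
  [/\ 3 <= m, 4 <= r & m * r = 2 * n].
Proof.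
split=> [[A [A_SMR _]]|[m_ge3 r_ge4 mr2n]].
  have mr := SMR_size _ _ _ _ _ A_SMR.
  have := SMR_row_size_neq2 _ _ _ _ _ A_SMR; rewrite mr => r_neq2.
  (* A column has two filled cells among its m cells; parity then improves m >= 2 to m >= 3. *)
  have m_ge2 : 1 < m.
    rewrite -(smr_col_filled A_SMR (Ordinal n_pos)) -[m in _ <= m]card_ord.
    exact: max_card.
  split=> //; last by have := r_neq2; lia.
  by lia.
have r_def : r = (r./2).*2 by rewrite -[LHS]odd_double_half (negbTE r_even).
have n_def : n = r./2 * m by lia.
have [|c [S c_parts]] := equal_sum_parts m r./2 m_odd; first lia.
(* This retypes the domain of [c] as the column index type ['I_n]. *)
move: c c_parts; rewrite -n_def => c c_parts.
have c_card i := (c_parts i).1; have c_sum i := (c_parts i).2.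
exists (cyclic_array m n c); split.
  rewrite r_def; apply: (cyclic_array_SMR _ _ _ S) => //; lia.
by apply: (cyclic_array_shiftable _ _ r./2) => //; lia.
Qed.
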